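(* Let $G$ be a finite simple undirected graph, let $r\in\mathbb{N}$ and let $\ell=\mathrm{wcol}_{2r}(G)$. Then splitter wins the simple $\ell$-round radius-$r$ splitter game on $G$.
   Context: For a linear order $L$ of $V(G)$ and $v\in V(G)$, a vertex $u$ is weakly $s$-reachable from $v$ with respect to $L$ if there is a path of length at most $s$ connecting $u$ and $v$ such that $u$ is the $L$-minimum vertex of the path; $\mathrm{WReach}_s[G,L,v]$ is the set of such vertices (it contains $v$), and $\mathrm{wcol}_s(G)=\min_L\max_{v\in V(G)}|\mathrm{WReach}_s[G,L,v]|$ over all linear orders $L$ of $V(G)$. For a graph $H$, $N_r^H(v)$ denotes the set of vertices at distance at most $r$ from $v$ in $H$. The simple $\ell$-round radius-$r$ splitter game on $G$ is played by connector and splitter: let $G_0:=G$; in round $i+1$ connector chooses a vertex $v_{i+1}\in V(G_i)$, then splitter picks a vertex $w_{i+1}\in N_r^{G_i}(v_{i+1})$, and $G_{i+1}:=G_i[N_r^{G_i}(v_{i+1})\setminus\{w_{i+1}\}]$. Splitter wins if $G_{i+1}$ is the empty graph; otherwise the game continues on $G_{i+1}$. If splitter has not won after $\ell$ rounds, connector wins. Splitter wins the game if she has a strategy (a function choosing her move from the history of the play and connector's current move) such that she wins every play in which she follows it. *)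

(* Defs.v *)
From mathcomp Require Import all_boot.

Set Implicit Arguments.
Unset Strict Implicit.
Unset Printing Implicit Defensive.

(* A finite simple undirected graph is a finite type T of vertices with a
   symmetric and irreflexive edge relation e : rel T. *)

(* x :: p is a path from x to y, with pairwise distinct vertices; its length is
   size p. *)
Definition gpath (T : finType) (e : rel T) (x : T) (p : seq T) (y : T) : bool :=
  [&& path e x p, uniq (x :: p) & last x p == y].

Section Wcol.
Variables (T : finType) (e : rel T).

Definition linear_order (L : {set T * T}) : bool :=
  [&& [forall x, (x, x) \in L],
      [forall x, forall y, ((x, y) \in L) && ((y, x) \in L) ==> (x == y)],
      [forall x, forall y, forall z,
         ((x, y) \in L) && ((y, z) \in L) ==> ((x, z) \in L)]
    & [forall x, forall y, ((x, y) \in L) || ((y, x) \in L)]].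

Definition WReach (s : nat) (L : {set T * T}) (v : T) : {set T} :=
  [set u | [exists k : 'I_s.+1, exists p : k.-tuple T,
     gpath e u p v && all (fun w => (u, w) \in L) (u :: p)]].

(* The default value #|T| of the minimum bounds every term and some linear
   order exists, so this is the true minimum: see wcol_min and wcol_attained. *)
Definition wcol (s : nat) : nat :=
  \big[minn/#|T|]_(L : {set T * T} | linear_order L) \max_(v : T) #|WReach s L v|.

Lemma linear_order_exists : exists L, linear_order L.
Proof.
exists [set x : T * T | enum_rank x.1 <= enum_rank x.2].
apply/and4P; split; apply/forallP => x; rewrite ?inE //=;
  apply/forallP => y; rewrite ?inE /=; last exact: leq_total.
- by apply/implyP => /anti_leq /val_inj /enum_rank_inj ->.
- by apply/forallP => z; rewrite !inE /=; apply/implyP => /andP[]; apply: leq_trans.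
Qed.

Lemma wcol_min s L : linear_order L -> wcol s <= \max_v #|WReach s L v|.
Proof.
move=> lL; rewrite /wcol; have := mem_index_enum L.
elim: (index_enum _) => // M S IH; rewrite inE big_cons.
case/predU1P => [<-|/IH {}IH]; first by rewrite lL geq_minl.
by case: ifP => // _; rewrite geq_min IH orbT.
Qed.

Lemma wcol_attained s :
  exists2 L, linear_order L & wcol s = \max_v #|WReach s L v|.
Proof.
have [L lL] := linear_order_exists.
have [w|//] : wcol s = #|T| \/
    exists2 L, linear_order L & wcol s = \max_v #|WReach s L v|.
  apply: (big_ind (fun m => m = #|T| \/
    exists2 L, linear_order L & m = \max_v #|WReach s L v|)); first by left.
  - by move=> m n hm hn; rewrite /minn; case: ifP.
  - by move=> M lM; right; exists M.
exists L => //; apply/eqP; rewrite eqn_leq wcol_min //= w.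
by apply/bigmax_leqP => v _; apply: max_card.
Qed.

End Wcol.

Section SplitterGame.
Variables (T : finType) (e : rel T) (r : nat).

(* Every graph occurring in the game is an induced subgraph of the initial
   graph, and is represented by its vertex set A.  ball A v is the set of
   vertices at distance at most r from v in the subgraph induced by A. *)
Definition ball (A : {set T}) (v : T) : {set T} :=
  [set u | [exists k : 'I_r.+1, exists p : k.-tuple T,
     gpath e v p u && all (mem A) (v :: p)]].

(* A position of the game is the chronological list of the rounds played so
   far, a round being the pair of connector's move and splitter's answer. *)
Definition next (A : {set T}) (vw : T * T) : {set T} := ball A vw.1 :\ vw.2.

Definition arena (h : seq (T * T)) : {set T} := foldl next [set: T] h.

Definition legal_play (h : seq (T * T)) : Prop :=
  forall h1 v w h2, h = h1 ++ (v, w) :: h2 ->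
    v \in arena h1 /\ w \in ball (arena h1) v.

Definition strategy := seq (T * T) -> T -> T.

Definition legal_strategy (f : strategy) : Prop :=
  forall h v, legal_play h -> v \in arena h -> f h v \in ball (arena h) v.

Definition follows (f : strategy) (h : seq (T * T)) : Prop :=
  forall h1 v w h2, h = h1 ++ (v, w) :: h2 -> w = f h1 v.

(* The game stops when the arena is empty (splitter has won) or when l rounds
   have been played. *)
Definition play_over (l : nat) (h : seq (T * T)) : Prop :=
  size h = l \/ (size h <= l /\ arena h = set0).

Definition splitter_wins (l : nat) : Prop :=
  exists f : strategy, legal_strategy f /\
    forall h, legal_play h -> follows f h -> play_over l h -> arena h = set0.

End SplitterGame.

(* Main.v *)
(** Fix a linear order [L] witnessing [wcol_2r], and let splitter always answer
    with the [L]-minimum [w] of the ball chosen by connector.  For every vertex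
    [u] of that ball, going from [w] to the centre and on to [u] gives a walk of
    length at most [2r] inside the ball, so [w] is weakly [2r]-reachable from
    [u].  Splitter's answers are pairwise distinct and leave the arena, so a
    vertex surviving [k] rounds weakly reaches [k] answers as well as itself;
    hence fewer than [wcol_2r] rounds can be survived. *)
Require Import Defs.
From mathcomp Require Import all_boot.

Set Implicit Arguments.
Unset Strict Implicit.
Unset Printing Implicit Defensive.

Section LinearOrder.
Variables (T : finType) (L : {set T * T}).
Hypothesis linL : linear_order L.

Definition order_rel : rel T := fun x y => (x, y) \in L.

Lemma order_rel_refl : reflexive order_rel.
Proof. by move=> x; case/and4P: linL => /forallP /(_ x). Qed.

Lemma order_rel_trans : transitive order_rel.
Proof.
move=> y x z xy yz; case/and4P: linL => _ _ /forallP/(_ x)/forallP/(_ y) + _.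
by move=> /forallP/(_ z)/implyP; apply; apply/andP.
Qed.

Lemma order_rel_total : total order_rel.
Proof. by move=> x y; case/and4P: linL => _ _ _ /forallP/(_ x)/forallP/(_ y). Qed.

End LinearOrder.

Section Walks.
Variables (T : finType) (e : rel T).

(** Shortening a walk only drops vertices, so any condition imposed on all vertices of the walk
    survives. This lets [WReachP] and [ballP] trade simple paths for walks, which can be
    concatenated freely. *)
Lemma gpath_of_walk x p :
  path e x p -> exists q, [/\ gpath e x q (last x p), size q <= size p
                            & {subset q <= p}].
Proof.
move=> /shortenP[q eq_q uq sq]; exists q; split=> //.
  by rewrite /gpath eq_q uq eqxx.
by case/andP: uq => _ uq; apply: uniq_leq_size.
Qed.

Lemma WReachP s (L : {set T * T}) v u :
  reflect (exists p, [/\ path e u p, last u p = v, size p <= s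
                       & {in u :: p, forall x, (u, x) \in L}])
          (u \in WReach e s L v).
Proof.
rewrite inE; apply: (iffP existsP) => [[k /existsP[p /andP[gp /allP Lp]]]|].
  case/and3P: gp => ep _ /eqP lp.
  by exists p; split; rewrite ?size_tuple // -ltnS.
case=> p [/gpath_of_walk[q [gq sq pq]] lp sp Lp].
have sqs : size q < s.+1 by rewrite ltnS (leq_trans sq).
exists (Ordinal sqs); apply/existsP; exists (in_tuple q).
rewrite -lp gq; apply/allP => x xq; apply: Lp; move: xq; rewrite !inE.
by case/orP => [->//|/pq ->]; rewrite orbT.
Qed.

Lemma ballP r (A : {set T}) v u :
  reflect (exists p, [/\ path e v p, last v p = u, size p <= r
                       & {subset v :: p <= A}])
          (u \in ball e r A v).
Proof.
rewrite inE; apply: (iffP existsP) => [[k /existsP[p /andP[gp /allP Ap]]]|].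
  case/and3P: gp => ep _ /eqP lp.
  by exists p; split; rewrite ?size_tuple // -ltnS.
case=> p [/gpath_of_walk[q [gq sq pq]] lp sp Ap].
have sqs : size q < r.+1 by rewrite ltnS (leq_trans sq).
exists (Ordinal sqs); apply/existsP; exists (in_tuple q).
rewrite -lp gq; apply/allP => x xq; apply: Ap; move: xq; rewrite !inE.
by case/orP => [->//|/pq ->]; rewrite orbT.
Qed.

Lemma WReach_refl s L v : linear_order L -> v \in WReach e s L v.
Proof.
move=> linL; apply/WReachP; exists [::]; split=> // x.
by rewrite inE => /eqP ->; apply: order_rel_refl.
Qed.

Lemma ball_center r (A : {set T}) v : v \in A -> v \in ball e r A v.
Proof.
by move=> vA; apply/ballP; exists [::]; split=> // x; rewrite inE => /eqP ->.
Qed.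

Lemma ball_subset r (A : {set T}) v : ball e r A v \subset A.
Proof. by apply/subsetP => u /ballP[p [_ <- _]]; apply; apply: mem_last. Qed.

(** Each vertex of the walk ends a prefix of it, which is itself a walk from [v] in [A] of length at
    most [r]. *)
Lemma walk_in_ball r (A : {set T}) v p :
  path e v p -> size p <= r -> {subset v :: p <= A} ->
  {subset v :: p <= ball e r A v}.
Proof.
move=> + + + x xp; case/splitPl: xp => p1 p2 lp1.
rewrite cat_path size_cat => /andP[ep1 _] sp Ap; apply/ballP; exists p1.
split=> // [|y yp1]; first exact: leq_trans (leq_addr _ _) sp.
by apply: Ap; rewrite -cat_cons mem_cat yp1.
Qed.

Lemma ball_min_WReach (e_sym : symmetric e) r (A : {set T}) (L : {set T * T}) v w u :
    w \in ball e r A v -> u \in ball e r A v ->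
    {in ball e r A v, forall x, (w, x) \in L} ->
  w \in WReach e (2 * r) L u.
Proof.
move=> /ballP[p [ep lp sp Ap]] /ballP[q [eq_q lq sq Aq]] Lw.
(* [rev (belast v p)] is the walk [p] traversed backwards from [w] to [v], with its starting vertex
   [w] left out. *)
have back : last w (rev (belast v p)) = v.
  by case: (p) lp => //= a s _; rewrite rev_cons last_rcons.
apply/WReachP; exists (rev (belast v p) ++ q); split.
- rewrite cat_path back eq_q andbT -lp rev_path.
  by rewrite (@eq_path _ _ e).
- by rewrite last_cat back.
- by rewrite size_cat size_rev size_belast mul2n -addnn leq_add.
- move=> x; rewrite inE mem_cat mem_rev => xin; apply: Lw.
  (* Every vertex of the concatenation lies on [v :: p] or on [q], and both walks start at the
     centre, so they stay in the ball. *)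
  have [|xp] := boolP (x \in v :: p); first exact: walk_in_ball.
  apply: (walk_in_ball eq_q sq Aq); rewrite inE.
  case/or3P: xin => [/eqP xw|/mem_belast xb|->]; last by rewrite orbT.
    by rewrite xw -lp mem_last in xp.
  by rewrite xb in xp.
Qed.

End Walks.

Section Strategy.
Variables (T : finType) (e : rel T) (e_sym : symmetric e) (r : nat).
Variables (L : {set T * T}) (linL : linear_order L).

(** The default [v] is harmless: after a move [v] in the arena, the ball contains [v], so a minimum
    exists. *)
Definition min_strategy : strategy T := fun h v =>
  extremum (order_rel L) v (mem (ball e r (arena e r h) v)) id.

Lemma min_strategyP h v : v \in arena e r h ->
  min_strategy h v \in ball e r (arena e r h) v /\
  {in ball e r (arena e r h) v, forall x, (min_strategy h v, x) \in L}.
Proof.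
move=> vA; rewrite /min_strategy.
case: (extremumP _ (order_rel_refl linL) (order_rel_trans linL)
         (order_rel_total linL) (ball_center e r vA)) => w wB wmin.
by split=> // x /wmin.
Qed.

Lemma legal_play_rcons h x : legal_play e r (rcons h x) ->
  [/\ legal_play e r h, x.1 \in arena e r h & x.2 \in ball e r (arena e r h) x.1].
Proof.
case: x => v w lh; split=> [h1 v1 w1 h2 hE||].
- by apply: (lh _ _ _ (rcons h2 (v, w))); rewrite hE rcons_cat.
- by case: (lh h v w [::]); rewrite ?cats1.
- by case: (lh h v w [::]); rewrite ?cats1.
Qed.

Lemma follows_rcons (f : strategy T) h x : follows f (rcons h x) ->
  follows f h /\ x.2 = f h x.1.
Proof.
case: x => v w fh; split=> [h1 v1 w1 h2 hE|].
- by apply: (fh _ _ _ (rcons h2 (v, w))); rewrite hE rcons_cat.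
- by apply: (fh h v w [::]); rewrite cats1.
Qed.

(** Induction on the last round. The new answer lies in the current arena, which older answers have
    left, hence it is distinct from them. Since arenas only shrink, the claims about older answers
    persist. *)
Lemma answers_WReach h : legal_play e r h -> follows min_strategy h ->
  [/\ uniq (unzip2 h), {in unzip2 h, forall w, w \notin arena e r h}
    & {in unzip2 h & arena e r h, forall w u, w \in WReach e (2 * r) L u}].
Proof.
elim/last_ind: h => [|h [v w] IH]; first by split.
move=> /legal_play_rcons[/= lh vA wB] /follows_rcons[/= fh wE].
have [uh outh reach] := IH lh fh.
have /subsetP BA := ball_subset e r (arena e r h) v.
have [_] := min_strategyP vA; rewrite -wE => wmin.
have -> : unzip2 (rcons h (v, w)) = rcons (unzip2 h) w by rewrite /unzip2 map_rcons.
have -> : arena e r (rcons h (v, w)) = ball e r (arena e r h) v :\ w.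
  by rewrite /arena foldl_rcons.
split.
- by rewrite rcons_uniq uh andbT; apply/negP => /outh; rewrite BA.
- move=> x; rewrite mem_rcons in_setD1 inE => /predU1P[->|/outh xA].
    by rewrite eqxx.
  by rewrite negb_and (contra (BA x) xA) orbT.
- move=> x u; rewrite mem_rcons inE => /predU1P[->|xh] /setD1P[_ uB].
    exact: ball_min_WReach wB uB wmin.
  exact: reach xh (BA _ uB).
Qed.

Lemma survived_rounds_lt h u : legal_play e r h -> follows min_strategy h ->
  u \in arena e r h -> size h < #|WReach e (2 * r) L u|.
Proof.
move=> lh fh uA; have [uh outh reach] := answers_WReach lh fh.
(* The survivor [u] is in the arena, hence is none of the answers; counting it too makes the bound
   strict. *)
have us : uniq (u :: unzip2 h).
  by rewrite /= uh andbT; apply/negP => /outh; rewrite uA.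
rewrite -(size_map snd) -[(size _).+1]/(size (u :: unzip2 h)) cardE.
apply: uniq_leq_size us _ => x; rewrite mem_enum inE => /predU1P[->|xh].
  exact: WReach_refl.
exact: reach.
Qed.

End Strategy.

Theorem theorem6 (T : finType) (e : rel T) (e_sym : symmetric e)
    (e_irr : irreflexive e) (r : nat) :
  splitter_wins e r (wcol e (2 * r)).
Proof.
have [L linL ->] := wcol_attained e (2 * r).
exists (min_strategy e r L); split=> [h v _ vA|h lh fh].
  by case: (min_strategyP linL vA).
(* If all rounds were played, a survivor [u] would weakly reach more vertices than the maximum over
   all vertices. *)
case=> [sh|[]//]; apply/eqP; rewrite -subset0; apply/subsetP => u uA.
have := survived_rounds_lt e_sym linL lh fh uA.
by rewrite sh ltnNge (leq_bigmax (F := fun v => #|WReach e (2 * r) L v|)).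
Qed.
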